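(* In the setting of the context, assume that for any $(x,z)\in\overline X\times\overline X$ the minimization problem $\min_y\{f(z,y):G(x,y)\le0\}$ has a nonempty solution set. Then the function $$\psi(x)=\begin{cases}\min_y\{f(x,y):G(x,y)\le0\}&\text{if }x\in\overline X,\\+\infty&\text{if }x\notin\overline X\end{cases}$$ is an implicitly convex-concave function associated with the lifted function $$\overline\psi(x,z)=\begin{cases}\min_y\{f(z,y):G(x,y)\le0\}&\text{if }x,z\in\overline X,\\+\infty&\text{if }x\notin\overline X,\\-\infty&\text{if }x\in\overline X,\ z\notin\overline X.\end{cases}$$
   Context: Setting. $\overline X\subseteq\mathbb R^{n_1}$ is a nonempty convex compact set; $f:\mathbb R^{n_1+n_2}\to\mathbb R$ and $G=(g_1,\dots,g_\ell)^\top:\mathbb R^{n_1+n_2}\to\mathbb R^\ell$ are continuous; $f(\cdot,y)$ is concave for every $y\in\mathbb R^{n_2}$, $f(x,\cdot)$ is convex for every $x\in\mathbb R^{n_1}$, and each $g_i$ is jointly convex. Definition. For an extended-real-valued function $\theta$, $\operatorname{dom}\theta=\{x:\theta(x)<+\infty\}$. A function $\theta:\mathbb R^n\to\mathbb R\cup\{+\infty\}$ with $\operatorname{dom}\theta$ convex is implicitly convex-concave, associated with the lifted function $\overline\theta:\mathbb R^n\times\mathbb R^n\to\mathbb R\cup\{\pm\infty\}$, if: (a) $\overline\theta(x,z)=+\infty$ if $x\notin\operatorname{dom}\theta$, $z\in\mathbb R^n$, and $\overline\theta(x,z)=-\infty$ if $x\in\operatorname{dom}\theta$, $z\notin\operatorname{dom}\theta$;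 (b) $\overline\theta(\cdot,z)$ is convex for any fixed $z\in\operatorname{dom}\theta$; (c) $\overline\theta(x,\cdot)$ is concave for any fixed $x\in\operatorname{dom}\theta$; (d) $\theta(x)=\overline\theta(x,x)$ for any $x\in\operatorname{dom}\theta$. *)

(* Defs.v *)
From mathcomp Require Import all_boot all_order all_algebra.
From mathcomp Require Import all_classical all_reals all_analysis.

Set Implicit Arguments.
Unset Strict Implicit.
Unset Printing Implicit Defensive.

Import Order.TTheory GRing.Theory Num.Theory.
Import numFieldNormedType.Exports.

Local Open Scope classical_set_scope.
Local Open Scope ring_scope.

Section ExtendedRealConvexity.
Context {R : realType} {n : nat}.

Definition epigraph (h : 'rV[R]_n -> \bar R) : set ('rV[R]_n * R^o)%type :=
  [set xa | (h xa.1 <= (xa.2 : R)%:E)%E].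

(* [convex_function] only covers real values; an extended-real-valued function,
   which may take both infinite values, is convex when its epigraph is. *)
Definition econvex (h : 'rV[R]_n -> \bar R) : Prop :=
  convex_set (epigraph h).

Definition econcave (h : 'rV[R]_n -> \bar R) : Prop :=
  econvex (fun x => - h x)%E.

Definition edom (theta : 'rV[R]_n -> \bar R) : set 'rV[R]_n :=
  [set x | (theta x < +oo)%E].

Record implicitly_convex_concave
    (theta : 'rV[R]_n -> \bar R) (theta_bar : 'rV[R]_n -> 'rV[R]_n -> \bar R)
    : Prop := ImplicitlyConvexConcave {
  icc_ninfty : forall x, theta x != -oo%E ;
  icc_dom : convex_set (edom theta) ;
  icc_off_left : forall x z, ~ edom theta x -> theta_bar x z = +oo%E ;
  icc_off_right : forall x z,
    edom theta x -> ~ edom theta z -> theta_bar x z = -oo%E ;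
  icc_convex : forall z, edom theta z -> econvex (theta_bar^~ z) ;
  icc_concave : forall x, edom theta x -> econcave (theta_bar x) ;
  icc_diag : forall x, edom theta x -> theta x = theta_bar x x
}.

End ExtendedRealConvexity.

Section Minimization.
Context {R : realType} {T : Type}.

Definition argmin (h : T -> R) (S : set T) : set T :=
  [set y | S y /\ forall y', S y' -> h y <= h y'].

(* The infimum, so that the value is total; it is a minimum as soon as
   [argmin h S] is nonempty, by [min_valueE]. *)
Definition min_value (h : T -> R) (S : set T) : \bar R :=
  ereal_inf [set (h y)%:E | y in S].

Lemma min_valueE (h : T -> R) (S : set T) (y : T) :
  argmin h S y -> min_value h S = (h y)%:E.
Proof.
move=> [Sy hy]; apply/eqP; rewrite eq_le; apply/andP; split.
  by apply: ereal_inf_lbound; exists y.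
by apply: le_ereal_inf_tmp => _ [y' Sy' <-]; rewrite lee_fin; exact: hy.
Qed.

End Minimization.

Section ValueFunction.
Context {R : realType} {n1 n2 l : nat}.
Variables (X : set 'rV[R]_n1) (f : 'rV[R]_(n1 + n2) -> R)
  (G : 'rV[R]_(n1 + n2) -> 'rV[R]_l).

Definition feasible (x : 'rV[R]_n1) : set 'rV[R]_n2 :=
  [set y | forall i, G (row_mx x y) ord0 i <= 0].

Definition psi (x : 'rV[R]_n1) : \bar R :=
  if x \in X then min_value (fun y => f (row_mx x y)) (feasible x)
  else +oo%E.

Definition psi_bar (x z : 'rV[R]_n1) : \bar R :=
  if x \in X then
    if z \in X then min_value (fun y => f (row_mx z y)) (feasible x)
    else -oo%E
  else +oo%E.

End ValueFunction.

(* Main.v *)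
(* The constraint set {(x, y) | G (x, y) <= 0} is jointly convex, so for fixed z
   the minimum over y of f (z, y) is a partial minimization of a jointly convex
   function of (x, y), hence convex in x. For fixed x it is an infimum, over a
   feasible set that does not depend on z, of functions concave in z. *)
Require Import Defs.
From mathcomp Require Import all_boot all_order all_algebra.
From mathcomp Require Import all_classical all_reals all_analysis.
Import Order.TTheory GRing.Theory Num.Theory.
Import numFieldNormedType.Exports.
Local Open Scope classical_set_scope.
Local Open Scope ring_scope.

Local Open Scope convex_scope.

Lemma ler_conv {R : numDomainType} (t : {i01 R}) {a b a' b' : R^o} :
  a <= a' -> b <= b' -> a <| t |> b <= a' <| t |> b'.
Proof.
move=> aa' bb'; rewrite !convRE.
by apply: lerD; apply: ler_wpM2l => //; rewrite subr_ge0.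
Qed.

(** Concatenation is linear. This carries the joint convexity of [G], stated for vectors [u], over
    to pairs [(x, y)]. *)
Lemma row_mx_conv (R : numDomainType) (m n : nat) (t : {i01 R})
    (x x' : convex_lmodType 'rV[R]_m) (y y' : convex_lmodType 'rV[R]_n) :
  row_mx (x <| t |> x') (y <| t |> y') =
  (row_mx x y : convex_lmodType 'rV[R]_(m + n)) <| t |> row_mx x' y'.
Proof. by rewrite [RHS]/conv /= !scale_row_mx add_row_mx. Qed.

(** From left to right a minimizer is the witness; an infimum that is not attained could equal [a]
    with every value of [h] above [a]. *)
Lemma min_value_leP {R : realType} {T : Type} {h : T -> R} {S : set T} (a : R) :
  argmin h S !=set0 ->
  (min_value h S <= a%:E)%E <-> exists2 y, S y & h y <= a.
Proof.
move=> [y0 hy0]; rewrite (min_valueE hy0) lee_fin.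
case: hy0 => Sy0 y0_min; split=> [|[y Sy]]; first by exists y0.
exact/le_trans/y0_min.
Qed.

(** The number [- a] is at most the infimum exactly when it is a lower bound of [h] on [S]. *)
Lemma oppe_min_value_leP {R : realType} {T : Type} {h : T -> R} {S : set T}
    {a : R} :
  (- min_value h S <= a%:E)%E <-> forall y, S y -> - h y <= a.
Proof.
rewrite leeNl -EFinN; split=> [ha y Sy|ha].
  rewrite lerNl -lee_fin; apply: (le_trans ha).
  by apply: ereal_inf_lbound; exists y.
apply: le_ereal_inf_tmp => _ [y Sy <-]; rewrite lee_fin lerNl; exact: ha.
Qed.

Section ValueFunctionConvexity.
Context {R : realType} {n1 n2 l : nat}.
Variables (X : set 'rV[R]_n1) (f : 'rV[R]_(n1 + n2) -> R)
  (G : 'rV[R]_(n1 + n2) -> 'rV[R]_l).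
Hypothesis X_convex : convex_set X.

Lemma feasible_conv (t : {i01 R}) (x x' : convex_lmodType 'rV[R]_n1)
    (y y' : convex_lmodType 'rV[R]_n2) :
  (forall i : 'I_l,
    convex_function setT (fun u : 'rV[R]_(n1 + n2) => G u ord0 i)) ->
  feasible G x y -> feasible G x' y' ->
  feasible G (x <| t |> x') (y <| t |> y').
Proof.
move=> G_convex xy x'y' i; rewrite row_mx_conv.
apply: le_trans (G_convex i t _ _ (in_setT _) (in_setT _)) _.
(* Zero is read as the combination of 0 with itself, then compared term by term with the two
   nonpositive constraint values. *)
by rewrite -(convmm t (0 : R^o)); apply: ler_conv; [exact: xy|exact: x'y'].
Qed.

(** Since the minimum is attained, the epigraph is the projection along [y] of a set of triples
    [(x, y, a)]; the value [+oo] leaves no point outside [X]. *)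
Lemma epigraph_psi_bar_left (z : 'rV[R]_n1) : X z ->
  (forall x, X x -> argmin (fun y => f (row_mx z y)) (feasible G x) !=set0) ->
  epigraph ((psi_bar X f G)^~ z) =
  [set xa | X xa.1 /\ exists2 y, feasible G xa.1 y & f (row_mx z y) <= xa.2].
Proof.
move=> Xz solvable; apply/seteqP; split=> -[x a]; rewrite /epigraph /psi_bar /=;
  rewrite (mem_set Xz).
  case: ifPn => [/set_mem Xx /(min_value_leP _ (solvable _ Xx))//|_].
  by rewrite leye_eq.
by move=> [Xx /(min_value_leP _ (solvable _ Xx))]; rewrite mem_set.
Qed.

(** Over [X] this is an intersection, over the feasible [y], of epigraphs of [- f (row_mx z y)] in
    [z]; outside [X] the negated [-oo] leaves no point. *)
Lemma epigraph_oppe_psi_bar (x : 'rV[R]_n1) : X x ->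
  epigraph (fun z => - psi_bar X f G x z)%E =
  [set za | X za.1 /\
    forall y, feasible G x y -> - f (row_mx za.1 y) <= za.2].
Proof.
move=> Xx; apply/seteqP; split=> -[z a]; rewrite /epigraph /psi_bar /=;
  rewrite (mem_set Xx).
  by case: ifPn => [/set_mem Xz /oppe_min_value_leP//|_]; rewrite leye_eq.
by move=> [Xz /oppe_min_value_leP]; rewrite mem_set.
Qed.

Lemma econvex_psi_bar (z : 'rV[R]_n1) : X z ->
  (forall x, X x -> argmin (fun y => f (row_mx z y)) (feasible G x) !=set0) ->
  convex_function setT (fun y : 'rV[R]_n2 => f (row_mx z y)) ->
  (forall i : 'I_l,
    convex_function setT (fun u : 'rV[R]_(n1 + n2) => G u ord0 i)) ->
  econvex ((psi_bar X f G)^~ z).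
Proof.
move=> Xz solvable f_convex G_convex; rewrite /econvex epigraph_psi_bar_left//.
move=> [x a] [x' a'] t /set_mem[/= Xx [y xy fya]] /set_mem[/= Xx' [y' x'y' fya']].
apply/mem_set; split=> /=; first exact/set_mem/X_convex/mem_set/Xx'/mem_set.
(* Combining the two witnesses works: joint convexity of the constraints makes the result feasible
   at the combined [x], and convexity of [f] in [y] bounds its cost. *)
exists ((y : convex_lmodType _) <| t |> y'); first exact: feasible_conv.
apply: le_trans (f_convex t _ _ (in_setT _) (in_setT _)) _.
exact: (ler_conv _ fya fya').
Qed.

Lemma econcave_psi_bar (x : 'rV[R]_n1) : X x ->
  (forall y : 'rV[R]_n2,
    convex_function setT (fun z : 'rV[R]_n1 => - f (row_mx z y))) ->
  econcave (psi_bar X f G x).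
Proof.
move=> Xx f_concave; rewrite /econcave /econvex epigraph_oppe_psi_bar//.
move=> [z a] [z' a'] t /set_mem[/= Xz fza] /set_mem[/= Xz' fza'].
apply/mem_set; split=> /= [|y xy].
  exact/set_mem/X_convex/mem_set/Xz'/mem_set.
(* The feasible set depends on [x] alone, so the same [y] serves at both [z] and [z']. *)
apply: le_trans (f_concave y t _ _ (in_setT _) (in_setT _)) _.
by apply: ler_conv; [exact: fza|exact: fza'].
Qed.

End ValueFunctionConvexity.

Theorem proposition1 (R : realType) (n1 n2 l : nat)
    (X : set 'rV[R]_n1) (f : 'rV[R]_(n1 + n2) -> R)
    (G : 'rV[R]_(n1 + n2) -> 'rV[R]_l)
    (X_nonempty : X !=set0)
    (X_convex : convex_set X)
    (X_compact : compact X)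
    (f_continuous : continuous f)
    (G_continuous : continuous G)
    (f_concave : forall y : 'rV[R]_n2,
      convex_function setT (fun x : 'rV[R]_n1 => - f (row_mx x y)))
    (f_convex : forall x : 'rV[R]_n1,
      convex_function setT (fun y : 'rV[R]_n2 => f (row_mx x y)))
    (G_convex : forall i : 'I_l,
      convex_function setT (fun u : 'rV[R]_(n1 + n2) => G u ord0 i))
    (solvable : forall x z : 'rV[R]_n1, X x -> X z ->
      argmin (fun y => f (row_mx z y)) (feasible G x) !=set0) :
  implicitly_convex_concave (psi X f G) (psi_bar X f G).
Proof.
(* The diagonal case of [solvable] makes [psi] real on [X]; this identifies its domain and excludes
   [-oo]. *)
have psiE x : X x -> exists y, psi X f G x = (f (row_mx x y))%:E.
  move=> Xx; have [y hy] := solvable x x Xx Xx.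
  by exists y; rewrite /psi mem_set// (min_valueE hy).
have domE : edom (psi X f G) = X.
  apply/seteqP; split=> x; rewrite /edom /=.
    by rewrite /psi; case: ifPn => [/set_mem//|_]; rewrite ltxx.
  by move=> /psiE[y ->]; rewrite ltry.
split; rewrite ?domE//.
- move=> x; case: (pselect (X x)) => [/psiE[y ->]//|nXx].
  by rewrite /psi memNset.
- by move=> x z nXx; rewrite /psi_bar memNset.
- by move=> x z Xx nXz; rewrite /psi_bar mem_set// memNset.
(* Solvability is used off the diagonal here: [z] stays fixed while [x] ranges over [X]. *)
- by move=> z Xz; apply: econvex_psi_bar => // x Xx; exact: solvable.
- by move=> x Xx; exact: econcave_psi_bar.
- by move=> x Xx; rewrite /psi /psi_bar mem_set.
Qed.
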